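(* Let $X$ be a real-valued random variable with log-concave probability density function $f$ on $\mathbb{R}$, and let $1\le\alpha<\infty$. Put $C_\alpha=\frac{2}{\alpha}\Gamma\left(\frac{1}{\alpha}\right)(\alpha e)^{1/\alpha}$ and $D_\alpha=\Gamma(\alpha+1)^{1/\alpha}$. Then $$\log\left(\frac{\sigma_\alpha}{D_\alpha}\right)\le h(X)\le\log(C_\alpha\sigma_\alpha).$$
   Context: A probability density function (pdf, with respect to Lebesgue measure) $f:\mathbb{R}^n\to\mathbb{R}$ is log-concave if $f(\theta x+(1-\theta)y)\ge f(x)^\theta f(y)^{1-\theta}$ for all $x,y\in\mathbb{R}^n$ and $0\le\theta\le1$; here $n=1$. $\sigma_\alpha=\left(E\left[|X-E[X]|^\alpha\right]\right)^{1/\alpha}$. The differential entropy is $h(X)=-\int_{\mathbb{R}} f(x)\log f(x)\,dx$ with natural logarithm and the usual convention $0\log0=0$. $\Gamma$ is the gamma function. *)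

(* Defs.v *)
From HB Require Import structures.
From mathcomp Require Import all_boot all_order all_algebra.
From mathcomp Require Import all_classical all_reals all_analysis.

Set Implicit Arguments.
Unset Strict Implicit.
Unset Printing Implicit Defensive.

Import Order.TTheory GRing.Theory Num.Theory.
Import numFieldNormedType.Exports.

Local Open Scope classical_set_scope.
Local Open Scope ring_scope.

(* Meant for nonnegative [f].  [powR] has the value 1 at exponent 0 for every
   base, so [theta = 0] and [theta = 1] impose nothing, even where [f]
   vanishes. *)
Definition log_concave (R : realType) (f : R -> R) : Prop :=
  forall (x y theta : R), 0 <= theta -> theta <= 1 ->
    f x `^ theta * f y `^ (1 - theta) <= f (theta * x + (1 - theta) * y).

Definition has_pdf (d : measure_display) (T : measurableType d) (R : realType)
    (P : probability T R) (X : {RV P >-> R}) (f : R -> R) : Prop :=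
  [/\ measurable_fun setT f,
      forall x, 0 <= f x
    & forall A : set R, measurable A ->
        distribution P X A = (\int[lebesgue_measure]_(x in A) (f x)%:E)%E].

Definition Gamma (R : realType) (s : R) : R :=
  \int[lebesgue_measure]_(t in `]0, +oo[) (t `^ (s - 1) * expR (- t)).

(* The mean is centred through [fine], as in the library's [covariance]; the
   moment itself is kept in [\bar R]. *)
Definition sigma (d : measure_display) (T : measurableType d) (R : realType)
    (P : probability T R) (X : {RV P >-> R}) (alpha : R) : \bar R :=
  ('E_P[fun w => (`|X w - fine 'E_P[X]| `^ alpha)%R] `^ (1 / alpha))%E.

(* Since [ln 0 = 0], the integrand follows the convention 0 log 0 = 0. *)
Definition entropy (R : realType) (f : R -> R) : \bar R :=
  (- \int[lebesgue_measure]_x (f x * ln (f x))%:E)%E.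

Definition C_ (R : realType) (alpha : R) : R :=
  2 / alpha * Gamma (1 / alpha) * (alpha * expR 1) `^ (1 / alpha).

Definition D_ (R : realType) (alpha : R) : R :=
  Gamma (alpha + 1) `^ (1 / alpha).

(* Main.v *)
(* Upper bound: Gibbs' inequality against the density proportional to
   exp (- |x - m| ^ alpha / (alpha v)), where m is the mean and v the centred
   alpha-th moment; here log-concavity only ensures integrability.
   Lower bound: the entropy is the mean of the convex function - ln f, hence
   by Jensen's inequality at least - ln (f m).  On each side of m, f is
   compared with the exponential that has the same value at m and the same
   mass: the two cross exactly once, so the exponential has the larger
   alpha-th moment.  Summing the two sides gives
   f m ^ alpha * v <= Gamma (alpha + 1). *)

Require Import Defs.
From HB Require Import structures.
From mathcomp Require Import all_boot all_order all_algebra.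
From mathcomp Require Import all_classical all_reals all_analysis.
From mathcomp Require Import ring lra measurable_realfun.

Set Implicit Arguments.
Unset Strict Implicit.
Unset Printing Implicit Defensive.

Import Order.TTheory GRing.Theory Num.Theory.
Import numFieldNormedType.Exports.

Local Open Scope ring_scope.

(** The delicate point is the order of the estimates. Comparison with an exponential needs positive
    density at its base point, but positivity of [f m] is derived from [m] being the mean, so the
    mean must first be known to be finite. The moment comparison is therefore proved at an arbitrary
    point [y] with [0 < f y]. Used with exponent 1 at any such point it makes the mean finite;
    positivity at [m] follows, and the comparison is used again at [m] with exponent [alpha]. Both
    entropy bounds come from pointwise bounds on [f ln f]: [1 + y <= exp y] from below, a supporting
    line of [ln f] at [m] from above. Both bounding functions are integrable, so [f ln f] is too,
    and its integral is an honest real number. *)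

(** * Affine change of variables for Lebesgue measure *)

Section affine.
Context {R : realType}.
Local Notation mu := (@lebesgue_measure R).

(** By uniqueness of Lebesgue measure it is enough to treat the intervals []a, b]]. A negative [c]
    swaps the open and the closed end, which leaves the length unchanged. *)
Lemma lebesgue_measure_affine (m c : R) (A : set R) : c != 0 -> measurable A ->
  (`|c|%:E * mu ((fun x => m + c * x)%R @^-1` A) = mu A)%E.
Proof.
move=> c0 mA.
pose phi : measurableTypeR R -> measurableTypeR R := fun x => m + c * x.
have mphi : measurable_fun setT phi.
  by apply: measurable_funD => //; exact: measurable_funM.
pose nu := mscale (NngNum (normr_ge0 c)) (pushforward mu phi).
rewrite -[LHS]/(nu mphi A); apply/esym; apply: (@lebesgue_measure_unique R (nu mphi)) => // _ [[a b] _] <-.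
rewrite -[RHS]/(`|c|%:E * mu (phi @^-1` `]a, b]))%E.
move: c0; rewrite neq_lt => /orP[c0|c0].
  rewrite (_ : (phi @^-1` `]a, b])%classic = `[(b - m) / c, (a - m) / c[%classic); last first.
    apply/seteqP; split => x /=; rewrite !in_itv/= /phi ler_ndivrMr// ltr_ndivlMr// => /andP[]; lra.
  rewrite !lebesgue_measure_itv/= !lte_fin ltr_nM2r ?invr_lt0// ltrD2r.
  case: ifPn => _; last by rewrite mule0.
  by rewrite ltr0_norm// -EFinB -EFinM; congr EFin; field; rewrite lt_eqF.
rewrite (_ : (phi @^-1` `]a, b])%classic = `](a - m) / c, (b - m) / c]%classic); last first.
  apply/seteqP; split => x /=; rewrite !in_itv/= /phi ler_pdivlMr// ltr_pdivrMr// => /andP[]; lra.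
rewrite !lebesgue_measure_itv/= !lte_fin ltr_pM2r ?invr_gt0// ltrD2r.
case: ifPn => _; last by rewrite mule0.
by rewrite gtr0_norm// -EFinB -EFinM; congr EFin; field; rewrite gt_eqF.
Qed.

Lemma ge0_integral_affine (m c : R) (D : set R) (g : R -> \bar R) : c != 0 ->
  measurable D -> measurable_fun D g -> (forall x, D x -> 0 <= g x)%E ->
  (\int[mu]_(x in D) g x =
   `|c|%:E * \int[mu]_(x in (fun x => m + c * x)%R @^-1` D) g (m + c * x)%R)%E.
Proof.
move=> c0 mD mg g0.
pose phi : measurableTypeR R -> measurableTypeR R := fun x => m + c * x.
have mphi : measurable_fun setT phi.
  by apply: measurable_funD => //; exact: measurable_funM.
rewrite -(@ge0_integral_pushforward _ _ _ _ _ phi mphi mu D g)//; last first.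
  by move=> x /[!inE]; exact: g0.
rewrite -(@ge0_integral_mscale _ _ _ (pushforward mu phi) _ mD (NngNum (normr_ge0 c)))//.
by apply: eq_measure_integral => A mA _; exact: esym (lebesgue_measure_affine m c0 mA).
Qed.
End affine.

(** * Strict positivity of integrals *)

Section integral_gt0.
Local Open Scope ereal_scope.
Context d (T : measurableType d) (R : realType) (mu : {measure set T -> \bar R}).

Lemma integral_gt0 (D : set T) (f : T -> \bar R) : measurable D ->
  measurable_fun D f -> (forall x, D x -> 0 < f x) -> 0 < mu D ->
  0 < \int[mu]_(x in D) f x.
Proof.
move=> mD mf f0 D0; rewrite lt0e integral_ge0 ?andbT; last first.
  by move=> x /f0/ltW.
apply/negP => /eqP intf0.
have : \int[mu]_(x in D) `|f x| = 0.
  by rewrite -[RHS]intf0; apply: eq_integral => x /[!inE] /f0/ltW/gee0_abs.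
move=> /(ae_eq_integral_abs _ mD mf) [N [mN N0 DN]].
have : mu D <= mu N.
  apply: le_measure; rewrite ?inE// => x Dx; apply: DN => /= /(_ Dx) fx0.
  by have := f0 x Dx; rewrite fx0 ltxx.
by rewrite N0 leNgt D0.
Qed.

End integral_gt0.

(** * Gamma and exponential integrals on the half line *)

Section gamma.
Context {R : realType}.
Local Notation mu := (@lebesgue_measure R).

Lemma measurable_powR_expRN (D : set R) (p c : R) :
  measurable_fun D (fun t : R => (t `^ p * expR (- (c * t)))%:E).
Proof.
apply: measurable_funTS; apply/measurable_EFinP; apply: measurable_funM => //.
apply: measurableT_comp => //; apply: measurable_funN.
exact: measurable_funM.
Qed.

Lemma measurable_powR_expRN1 (D : set R) (p : R) :
  measurable_fun D (fun t : R => (t `^ p * expR (- t))%:E).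
Proof. by have := @measurable_powR_expRN D p 1; under eq_fun do rewrite mul1r. Qed.

Lemma measurable_expRNM (D : set R) (c : R) :
  measurable_fun D (fun t : R => (expR (- (c * t)))%:E).
Proof.
by have := @measurable_powR_expRN D 0 c; under eq_fun do rewrite powRr0 mul1r.
Qed.

Lemma integral_powR_expRN_scale (s c : R) : 0 < c ->
  (\int[mu]_(t in `]0%R, +oo[) (t `^ (s - 1) * expR (- (c * t)))%:E =
   (c `^ (- s))%:E * \int[mu]_(t in `]0%R, +oo[) (t `^ (s - 1) * expR (- t))%:E)%E.
Proof.
move=> c0.
have mg := @measurable_powR_expRN1 `]0, +oo[%classic (s - 1).
rewrite (ge0_integral_affine 0 (lt0r_neq0 c0) _ mg)//; last first.
  by move=> x _; rewrite lee_fin mulr_ge0 ?powR_ge0 ?expR_ge0.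
have -> : ((fun x => 0 + c * x) @^-1` `]0%R, +oo[ = `]0%R, +oo[)%classic.
  by apply/seteqP; split => x /=; rewrite !in_itv/= !andbT add0r pmulr_rgt0.
under [X in (_ * (_ * X))%E]eq_integral => x x0.
  rewrite add0r powRM ?(ltW c0)//; last first.
    by move: x0; rewrite inE/= in_itv/= andbT => /ltW.
  rewrite -mulrA EFinM; over.
rewrite ge0_integralZl//; first last.
- by rewrite lee_fin powR_ge0.
- by move=> x _; rewrite lee_fin mulr_ge0 ?powR_ge0 ?expR_ge0.
- exact: measurable_powR_expRN.
have -> : c `^ (s - 1) = c `^ s / c.
  by rewrite powRB ?powRr1 ?(ltW c0)//; apply/implyP => _; rewrite gt_eqF.
rewrite !muleA -!EFinM gtr0_norm// powRN.
have := powR_gt0 s c0; set u := c `^ s => u0.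
have -> : u^-1 * c * (u / c) = 1 by field; rewrite !gt_eqF.
by rewrite mul1e.
Qed.

Lemma integral_expRN : (\int[mu]_(t in `]0%R, +oo[) (expR (- t))%:E = 1)%E.
Proof.
rewrite -(@integral_exponential_pdf R 1 ltr01) integral_itv_obnd_cbnd; last first.
  by apply: measurable_funTS; apply/measurable_EFinP; exact: measurableT_comp.
rewrite [LHS]integral_mkcond; apply: eq_integral => x _.
by rewrite /exponential_pdf !patchE; case: ifPn => // _; rewrite mul1r mulN1r.
Qed.

Lemma integral_expRNM (c : R) : 0 < c ->
  (\int[mu]_(t in `]0%R, +oo[) (expR (- (c * t)))%:E = (c^-1)%:E)%E.
Proof.
move=> c0; have := @integral_powR_expRN_scale 1 c c0.
under eq_integral do rewrite subrr powRr0 mul1r.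
under [X in (_ * X)%E]eq_integral do rewrite subrr powRr0 mul1r.
by rewrite integral_expRN mule1 powR_inv1// ltW.
Qed.

(** Half of the exponential absorbs the power: raising [t <= 2 a exp (t / (2 a))] to the power
    [a = s - 1] gives [t ^ a exp (- t) <= (2 a) ^ a exp (- t / 2)]. At [a = 0] the constant is 1, by
    the value of [powR] at exponent 0. *)
Lemma Gamma_integral_lty (s : R) : 1 <= s ->
  (\int[mu]_(t in `]0%R, +oo[) (t `^ (s - 1) * expR (- t))%:E < +oo)%E.
Proof.
move=> s1; set a := s - 1; have a0 : 0 <= a by rewrite subr_ge0.
apply: (@le_lt_trans _ _
  (\int[mu]_(t in `]0%R, +oo[) (((2 * a) `^ a)%:E * (expR (- (2^-1 * t)))%:E))%E).
  apply: ge0_le_integral => //.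
  - by move=> x _; rewrite lee_fin mulr_ge0 ?powR_ge0 ?expR_ge0.
  - exact: measurable_powR_expRN1.
  - by apply: emeasurable_funM => //; exact: measurable_expRNM.
  - move=> x; rewrite /= in_itv/= andbT => x0; rewrite -EFinM lee_fin.
    rewrite (_ : - (2^-1 * x) = 2^-1 * x + - x); last by field.
    rewrite expRD mulrA ler_wpM2r ?expR_ge0//.
    have [->|an0] := eqVneq a 0; first by rewrite !powRr0 mul1r (le_trans _ (expR_ge1Dx _))//; lra.
    have ap : 0 < a by rewrite lt0r an0.
    have -> : expR (2^-1 * x) = expR (x / (2 * a)) `^ a.
      by rewrite -expRM; congr expR; field.
    rewrite -powRM ?expR_ge0//; last lra.
    apply: ge0_ler_powR; rewrite ?nnegrE ?(ltW x0)//.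
      by rewrite mulr_ge0 ?expR_ge0//; lra.
    apply: (@le_trans _ _ (2 * a * (1 + x / (2 * a)))).
      by rewrite mulrDr mulrCA divff ?mulr1 ?lerDr; lra.
    by rewrite ler_wpM2l ?expR_ge1Dx//; lra.
rewrite ge0_integralZl//; first last.
- by rewrite lee_fin powR_ge0.
- exact: measurable_expRNM.
by rewrite integral_expRNM ?invr_gt0// -EFinM ltry.
Qed.

(** [Gamma] is the [fine] part of the extended integral, so a divergent integral would be read as 0;
    this is why finiteness is carried as a hypothesis. *)
Lemma Gamma_EFin (s : R) :
  (\int[mu]_(t in `]0%R, +oo[) (t `^ (s - 1) * expR (- t))%:E < +oo)%E ->
  (Gamma s)%:E = (\int[mu]_(t in `]0%R, +oo[) (t `^ (s - 1) * expR (- t))%:E)%E.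
Proof.
move=> h; rewrite /Gamma /Rintegral fineK// ge0_fin_numE//.
by apply: integral_ge0 => x _; rewrite lee_fin mulr_ge0 ?powR_ge0 ?expR_ge0.
Qed.

Lemma Gamma_gt0 (s : R) :
  (\int[mu]_(t in `]0%R, +oo[) (t `^ (s - 1) * expR (- t))%:E < +oo)%E ->
  0 < Gamma s.
Proof.
move=> h; rewrite -lte_fin Gamma_EFin//; apply: integral_gt0 => //.
- exact: measurable_powR_expRN1.
- move=> x; rewrite /= in_itv/= andbT => x0.
  by rewrite lte_fin mulr_gt0 ?powR_gt0 ?expR_gt0.
- suff: (0 < mu `]0%R, +oo[)%E by [].
  by rewrite lebesgue_measure_itv/= ltry addye// ltry.
Qed.

End gamma.

(** * The substitution [t = u ^ a] and the Gamma integral at [1 / a] *)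

Section power_exponential.
Context {R : realType}.
Local Open Scope classical_set_scope.
Local Notation mu := (@lebesgue_measure R).

Lemma continuous_powR (p x : R) : 0 < x -> {for x, continuous (@powR R ^~ p)}.
Proof.
move=> x0; apply: differentiable_continuous; apply/derivable1_diffP.
by apply: derivable_powR; rewrite in_itv/= andbT.
Qed.

Lemma powR_cvgy (p : R) : 0 < p -> x `^ p @[x --> +oo] --> +oo.
Proof.
move=> p0; apply/cvgryPge => A; near=> x.
have xA : (`|A| `^ p^-1) <= x by near: x; apply: nbhs_pinfty_ge; rewrite num_real.
apply: (le_trans (ler_norm A)).
rewrite -[leLHS]powRr1// -(mulVf (lt0r_neq0 p0)) powRrM.
apply: ge0_ler_powR; rewrite ?nnegrE ?powR_ge0 ?(ltW p0)//.
Unshelve. all: by end_near. Qed.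

Lemma powRN_cvg0 (p : R) : 0 < p -> x `^ (- p) @[x --> +oo] --> 0.
Proof.
move=> p0; under eq_fun do rewrite powRN.
apply/gtr0_cvgV0; last exact: powR_cvgy.
by near=> x; apply: powR_gt0.
Unshelve. all: by end_near. Qed.

(** A side condition of the substitution rule on an unbounded interval: the derivative must have a
    finite limit at [+oo]. It does because [a - 1 <= 0]. *)
Lemma derive1_powR_cvgy (a : R) : 0 < a -> a <= 1 ->
  cvg ((@powR R ^~ a)^`()%classic x @[x --> +oo]).
Proof.
move=> a0 a1.
suff : cvg (a * x `^ (a - 1) @[x --> +oo]).
  move=> /cvg_ex[l cl]; apply/cvg_ex; exists l; apply: cvg_trans cl.
  apply: near_eq_cvg; near=> x.
  by rewrite powR_derive1// in_itv/= andbT; near: x; exact: nbhs_pinfty_gt.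
apply: is_cvgM; first exact: is_cvg_cst.
have [->|an1] := eqVneq a 1.
  by rewrite subrr; under eq_fun do rewrite powRr0; exact: is_cvg_cst.
have a1' : 0 < 1 - a by rewrite subr_gt0 lt_neqAle an1.
by apply/cvg_ex; exists 0; rewrite -(opprB 1 a); exact: powRN_cvg0.
Unshelve. all: by end_near. Qed.

Lemma continuous_derive1_powR (a x : R) : 0 < x ->
  {for x, continuous (@powR R ^~ a)^`()%classic}.
Proof.
move=> x0; rewrite /prop_for /continuous_at powR_derive1 ?in_itv/= ?andbT//.
have h : a * y `^ (a - 1) @[y --> x] --> a * x `^ (a - 1).
  by apply: cvgM; [exact: cvg_cst|exact: continuous_powR].
apply: cvg_trans h.
apply: near_eq_cvg; near=> y.
by rewrite powR_derive1// in_itv/= andbT; near: y; exact: lt_nbhsr.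
Unshelve. all: by end_near. Qed.

Lemma measurable_expRN (D : set R) :
  measurable_fun D (fun u : R => (expR (- u))%:E).
Proof. by apply: measurable_funTS; apply/measurable_EFinP; exact: measurableT_comp. Qed.

Lemma measurable_expRN_powR (D : set R) (a : R) :
  measurable_fun D (fun u : R => (expR (- u `^ a))%:E).
Proof.
apply: measurable_funTS; apply/measurable_EFinP; apply: measurableT_comp => //.
exact: measurable_funN.
Qed.

(** Substitution [u = t ^ (1 / a)]. The cutoff [e] keeps away from 0, where the derivative of this
    map blows up as soon as [a > 1]. *)
Lemma integral_expRN_powR_itvcy (a e : R) : 1 <= a -> 0 < e ->
  (\int[mu]_(u in `[(e `^ a^-1)%R, +oo[) (expR (- u `^ a))%:E =
   a^-1%:E * \int[mu]_(t in `[e, +oo[) (t `^ (a^-1 - 1) * expR (- t))%:E)%E.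
Proof.
move=> a1 e0.
have a0 : 0 < a by lra.
have ai0 : 0 < a^-1 by rewrite invr_gt0.
rewrite (@increasing_ge0_integration_by_substitutiony R (@powR R ^~ a^-1)
  (fun u => expR (- u `^ a)) e).
- rewrite -ge0_integralZl//; first last.
  + by rewrite lee_fin ltW.
  + by move=> x _; rewrite lee_fin mulr_ge0 ?powR_ge0 ?expR_ge0.
  + exact: measurable_powR_expRN1.
  apply: eq_integral => x; rewrite inE/= in_itv/= andbT => ex.
  have x0 : 0 < x by exact: lt_le_trans ex.
  rewrite -EFinM; congr EFin.
  transitivity (expR (- (x `^ a^-1) `^ a) * (@powR R ^~ a^-1)^`()%classic x); first by [].
  rewrite powR_derive1 ?in_itv/= ?andbT//.
  by rewrite -powRrM mulVf ?gt_eqF// powRr1 ?(ltW x0)// mulrC mulrA.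
- move=> x y; rewrite !in_itv/= !andbT => ex ey xy.
  by apply: gt0_ltr_powR; rewrite ?nnegrE//; lra.
- move=> x; rewrite in_itv/= andbT => ex.
  by apply: continuous_derive1_powR; exact: lt_trans ex.
- apply/cvg_ex; eexists; apply: cvg_at_right_filter.
  exact: continuous_derive1_powR.
- by apply: derive1_powR_cvgy => //; rewrite invf_le1.
- split.
  + move=> x; rewrite in_itv/= andbT => ex; apply: derivable_powR.
    by rewrite in_itv/= andbT; exact: lt_trans ex.
  + by apply: cvg_at_right_filter; exact: continuous_powR.
- exact: powR_cvgy.
- apply: continuous_in_subspaceT => x; rewrite inE/= in_itv/= andbT => ex.
  have x0 : 0 < x by apply: lt_le_trans ex; exact: powR_gt0.
  apply: continuous_comp; last exact: continuous_expR.
  by apply: continuousN; exact: continuous_powR.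
- by move=> x _; rewrite expR_ge0.
Qed.

(** Monotone convergence over the growing half lines; it removes the cutoff on both sides of the
    substitution formula. *)
Lemma cvg_integral_itvcy (f : R -> \bar R) (u : R^nat) :
  measurable_fun (`]0%R, +oo[ : set R) f -> (forall x, (0 < x)%R -> 0 <= f x)%E ->
  (forall n, 0 < u n) -> nonincreasing_seq u -> u n @[n --> \oo] --> 0 ->
  (\int[mu]_(x in `[u n, +oo[) f x @[n --> \oo] -->
   \int[mu]_(x in `]0%R, +oo[) f x)%E.
Proof.
move=> mf f0 u0 du cu.
have -> : (`]0%R, +oo[ = \bigcup_n `[u n, +oo[)%classic.
  apply/seteqP; split => x /=; rewrite in_itv/= andbT.
    move=> x0; have : \forall n \near \oo, u n < x.
      by move/cvgr_lt : cu; apply.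
    move=> [N _ /(_ N (leqnn _)) uN]; exists N => //=.
    by rewrite in_itv/= andbT ltW.
  by move=> [n _] /=; rewrite in_itv/= andbT; exact: lt_le_trans.
apply: ge0_nondecreasing_set_cvg_integral => //.
- apply/nondecreasing_seqP => n; apply/subsetPset => x /=.
  by rewrite !in_itv/= !andbT; apply: le_trans; exact: du.
- move=> n; apply: measurable_funS mf => // x /=.
  by rewrite !in_itv/= !andbT; exact: lt_le_trans.
- move=> n x /=; rewrite in_itv/= andbT => ux; apply: f0.
  exact: lt_le_trans ux.
Qed.

Lemma integral_expRN_powR (a : R) : 1 <= a ->
  (\int[mu]_(u in `]0%R, +oo[) (expR (- u `^ a))%:E =
   a^-1%:E * \int[mu]_(t in `]0%R, +oo[) (t `^ (a^-1 - 1) * expR (- t))%:E)%E.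
Proof.
move=> a1.
have a0 : 0 < a by lra.
have ai0 : 0 < a^-1 by rewrite invr_gt0.
have n0 n : 0 < n.+1%:R^-1 :> R by rewrite invr_gt0.
have n_noninc : nonincreasing_seq (fun n => n.+1%:R^-1 : R).
  by move=> m n mn; rewrite lef_pV2 ?posrE// ler_nat.
have cvg_n : n.+1%:R^-1 @[n --> \oo] --> (0 : R) by exact: cvg_harmonic.
have lhs : (\int[mu]_(u in `[(n.+1%:R^-1 `^ a^-1)%R, +oo[) (expR (- u `^ a))%:E
    @[n --> \oo] --> \int[mu]_(u in `]0%R, +oo[) (expR (- u `^ a))%:E)%E.
  apply: (@cvg_integral_itvcy _ (fun n => n.+1%:R^-1 `^ a^-1)) => //.
  - exact: measurable_expRN_powR.
  - move=> m n mn; apply: ge0_ler_powR; rewrite ?nnegrE ?(ltW ai0) ?(ltW (n0 _))//.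
    exact: n_noninc.
  (* The limit of [powR] at 0 is one-sided; positivity of the terms turns convergence to 0 into
     convergence from the right. *)
  - apply: (@cvg_comp _ _ _ _ (@powR R ^~ a^-1) _ (0^'+)); last exact: powR_cvg0.
    move=> A /cvg_n An.
    have {}An : \forall n \near \oo, 0 < n.+1%:R^-1 :> R -> A n.+1%:R^-1 by exact: An.
    have : \forall n \near \oo, A n.+1%:R^-1 by apply: filterS An => n; apply; exact: n0.
    by [].
apply: (cvg_unique _ lhs) => //.
rewrite /=; under eq_fun do rewrite integral_expRN_powR_itvcy//.
apply: cvgeZl => //.
apply: cvg_integral_itvcy => //.
- exact: measurable_powR_expRN1.
- by move=> x _; rewrite lee_fin mulr_ge0 ?powR_ge0 ?expR_ge0.
Qed.

(** The integrand may be singular at 0, but after the substitution it is [exp (- u ^ a)], which is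
    at most [e exp (- u)] because [u <= 1 + u ^ a]. *)
Lemma Gamma_inv_integral_lty (a : R) : 1 <= a ->
  (\int[mu]_(t in `]0%R, +oo[) (t `^ (a^-1 - 1) * expR (- t))%:E < +oo)%E.
Proof.
move=> a1; have a0 : 0 < a by lra.
have ai0 : 0 < a^-1 by rewrite invr_gt0.
suff : (\int[mu]_(u in `]0%R, +oo[) (expR (- u `^ a))%:E < +oo)%E.
  rewrite integral_expRN_powR//; set I := (\int[mu]_(t in _) _)%E.
  have : (0 <= I)%E.
    by apply: integral_ge0 => x _; rewrite lee_fin mulr_ge0 ?powR_ge0 ?expR_ge0.
  by case: I => [r| |]//= _; rewrite ?ltry// gt0_muley ?lte_fin.
apply: (@le_lt_trans _ _ (\int[mu]_(u in `]0%R, +oo[) ((expR 1)%:E * (expR (- u))%:E)))%E.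
  apply: ge0_le_integral => //.
  - exact: measurable_expRN_powR.
  - by apply: emeasurable_funM => //; exact: measurable_expRN.
  move=> x; rewrite /= in_itv/= andbT => x0.
  rewrite -EFinM lee_fin -expRD ler_expR.
  have [x1|x1] := leP 1 x; first by have := le1r_powR x1 a1; lra.
  by have := powR_ge0 x a; lra.
rewrite ge0_integralZl//; last exact: measurable_expRN.
by rewrite integral_expRN mule1 ltry.
Qed.

End power_exponential.

(** * Splitting at a point, and the mass of the generalized Gaussian *)

Section split_integral.
Context {R : realType}.
Local Open Scope classical_set_scope.
Local Notation mu := (@lebesgue_measure R).

Lemma ge0_integral_half_lines (m : R) (g : R -> \bar R) :
  measurable_fun (setT : set R) g -> (forall x, 0 <= g x)%E ->
  (\int[mu]_x g x = \int[mu]_(t in `]0%R, +oo[) g (m + t)%R +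
                    \int[mu]_(t in `]0%R, +oo[) g (m - t)%R)%E.
Proof.
move=> mg g0.
have mgS D : measurable_fun (D : set R) g by exact: measurable_funTS.
have right : (\int[mu]_(x in `]m, +oo[) g x = \int[mu]_(t in `]0%R, +oo[) g (m + t)%R)%E.
  rewrite (@ge0_integral_affine R m 1)// normr1 mul1e.
  under eq_integral do rewrite mul1r.
  congr (integral _ _ _); apply/seteqP; split => x /=; rewrite !in_itv/= !andbT; lra.
have left : (\int[mu]_(x in `]-oo, m[) g x = \int[mu]_(t in `]0%R, +oo[) g (m - t)%R)%E.
  rewrite (@ge0_integral_affine R m (-1))// ?oppr_eq0 ?oner_eq0// normrN1 mul1e.
  under eq_integral do rewrite mulN1r.
  congr (integral _ _ _); apply/seteqP; split => x /=; rewrite !in_itv/= ?andbT; lra.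
rewrite -right -left integral_itv_bndo_bndc// -(setUv `]m, +oo[%classic).
rewrite ge0_integral_setU//=; first last.
- by apply/disj_setPCl.
- by rewrite setUv.
- exact: measurableC.
by rewrite setCitvr.
Qed.

(** The right-hand side is the normalising constant of the comparison density in Gibbs'
    inequality. *)
Lemma integral_generalized_gaussian (m a v : R) : 1 <= a -> 0 < v ->
  (\int[mu]_x (expR (- (`|x - m| `^ a / (a * v))))%:E =
   (2 / a * Gamma (1 / a) * (a * v) `^ (1 / a))%:E)%E.
Proof.
move=> a1 v0; have a0 : 0 < a by lra.
have av0 : 0 < a * v by exact: mulr_gt0.
(* The scale with [c ^ a = a v]: substituting [t = c u] turns the exponent into [- u ^ a]. *)
set c := (a * v) `^ a^-1; have c0 : 0 < c by exact: powR_gt0.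
have ca : c `^ a = a * v by rewrite -powRrM mulVf ?gt_eqF// powRr1// ltW.
have mg D : measurable_fun (D : set R) (fun x : R => (expR (- (`|x| `^ a / (a * v))))%:E).
  apply: measurable_funTS; apply/measurable_EFinP; apply: measurableT_comp => //.
  apply: measurable_funN; apply: measurable_funM => //.
  by apply: (measurableT_comp (measurable_powR _)) => //; exact: normr_measurable.
have half : (\int[mu]_(t in `]0%R, +oo[) (expR (- (`|t| `^ a / (a * v))))%:E =
    (c * (a^-1 * Gamma a^-1))%:E)%E.
  rewrite (@ge0_integral_affine R 0 c)// ?gt_eqF// gtr0_norm//.
  rewrite EFinM EFinM Gamma_EFin; last exact: Gamma_inv_integral_lty.
  rewrite -integral_expRN_powR//; congr (_ * _)%E.
  rewrite (_ : (fun x => 0 + c * x) @^-1` `]0, +oo[ = `]0, +oo[); last first.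
    by apply/seteqP; split => x /=; rewrite !in_itv/= !andbT add0r pmulr_rgt0.
  apply: eq_integral => x; rewrite inE/= in_itv/= andbT => x0.
  rewrite add0r normrM !gtr0_norm// powRM ?(ltW c0) ?(ltW x0)// ca.
  by rewrite mulrAC divff ?mul1r ?gt_eqF.
rewrite (ge0_integral_half_lines m).
- under eq_integral do rewrite addrAC subrr add0r.
  under [X in (_ + X)%E]eq_integral do rewrite addrAC subrr add0r normrN.
  by rewrite half -EFinD; congr EFin; rewrite /c !div1r; field; rewrite gt_eqF.
- apply: (measurableT_comp (mg setT)).
  by apply: measurable_funB.
- by move=> x; rewrite lee_fin expR_ge0.
Qed.

End split_integral.

(** * Moments of log-concave functions compared with those of exponentials *)

Section moment.
Context {R : realType}.
Local Open Scope classical_set_scope.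
Local Notation mu := (@lebesgue_measure R).

Lemma log_concave_affine (f : R -> R) (m c : R) :
  log_concave f -> log_concave (fun x => f (m + c * x)).
Proof.
move=> lf x y t t0 t1; apply: le_trans (lf _ _ _ t0 t1) _.
by rewrite (_ : t * (m + c * x) + _ = m + c * (t * x + (1 - t) * y))//; ring.
Qed.

(* [ln (g t) + c t] is concave and equals [ln (g 0)] at [0]. *)
Lemma log_concave_below_exponential (g : R -> R) (c t1 t : R) :
  log_concave g -> (forall x, 0 <= g x) -> 0 < g 0 -> 0 < t1 -> t1 <= t ->
  g t1 < g 0 * expR (- (c * t1)) -> g t <= g 0 * expR (- (c * t)).
Proof.
move=> lg g_ge0 g0 t10 t1t gt1; rewrite leNgt; apply/negP => gt.
have t0 : 0 < t by exact: lt_le_trans t1t.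
(* Writes [t1] as the convex combination of [t] and [0] with weight [th]. The exponential is
   log-affine, so there its value at [t1] is exactly the geometric mean of its values at [t] and
   [0]. *)
pose th := t1 / t.
have th0 : 0 <= th by rewrite divr_ge0 ?ltW.
have th1 : th <= 1 by rewrite ler_pdivrMr ?mul1r.
have := lg t 0 th th0 th1.
rewrite mulr0 addr0 /th divfK ?gt_eqF// -/th => h.
have : g 0 * expR (- (c * t1)) <= g t1.
  apply: le_trans h.
  have -> : g 0 * expR (- (c * t1)) =
      (g 0 * expR (- (c * t))) `^ th * g 0 `^ (1 - th).
    rewrite powRM ?expR_ge0// -expRM mulrAC -powRD; last first.
      by apply/implyP => _; rewrite gt_eqF.
    rewrite subrKC powRr1//; congr (_ * expR _); rewrite /th.
    by field; rewrite gt_eqF.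
  rewrite ler_wpM2r ?powR_ge0//; apply: ge0_ler_powR => //; last exact: ltW.
  - by rewrite nnegrE mulr_ge0 ?expR_ge0.
  - by rewrite nnegrE.
by rewrite leNgt gt1.
Qed.

(* The exponential density with the same value at [0] and mass [p' > p] crosses
   [g] exactly once, from below to above, at [t0]; hence
   [(t ^ a - t0 ^ a) (g - k) <= 0] pointwise. *)
Lemma log_concave_moment_lt (g : R -> R) (a p p' : R) :
  measurable_fun (setT : set R) g -> (forall x, 0 <= g x) -> log_concave g ->
  0 < g 0 -> 0 <= a ->
  (\int[mu]_(t in `]0%R, +oo[) (g t)%:E = p%:E)%E -> p < p' ->
  (\int[mu]_(t in `]0%R, +oo[) (t `^ a * g t)%:E <=
   (Gamma (a + 1) / g 0 `^ a * p' `^ (a + 1))%:E)%E.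
Proof.
move=> mg g_ge0 lg g0 a0 gp pp'.
have p0 : 0 <= p.
  by rewrite -lee_fin -gp; apply: integral_ge0 => x _; rewrite lee_fin.
have p'0 : 0 < p' by exact: le_lt_trans pp'.
(* The rate for which [g 0 exp (- c t)] has mass [g 0 / c = p']. *)
pose c := g 0 / p'; have c0 : 0 < c by rewrite divr_gt0.
pose k t := g 0 * expR (- (c * t)).
have k0 t : 0 <= k t by rewrite mulr_ge0 ?expR_ge0// ltW.
have mgD D : measurable_fun (D : set R) g by exact: measurable_funTS.
have mk D : measurable_fun (D : set R) k.
  by apply: measurable_funM => //; apply/measurable_EFinP; exact: measurable_expRNM.
have intk : (\int[mu]_(t in `]0%R, +oo[) (k t)%:E = p'%:E)%E.
  under eq_integral do rewrite EFinM.
  rewrite ge0_integralZl//; last 2 first.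
  - exact: measurable_expRNM.
  - by rewrite lee_fin ltW.
  rewrite integral_expRNM// -EFinM /c; congr EFin.
  by field; rewrite !gt_eqF.
have intak : (\int[mu]_(t in `]0%R, +oo[) (t `^ a * k t)%:E =
    (Gamma (a + 1) / g 0 `^ a * p' `^ (a + 1))%:E)%E.
  under eq_integral do rewrite /k mulrCA EFinM.
  rewrite ge0_integralZl//; first last.
  - by rewrite lee_fin ltW.
  - by move=> x _; rewrite lee_fin mulr_ge0 ?powR_ge0 ?expR_ge0.
  - exact: measurable_powR_expRN.
  have := @integral_powR_expRN_scale R (a + 1) c c0; rewrite addrK => ->.
  have := @Gamma_integral_lty R (a + 1); rewrite addrK => lty.
  have := @Gamma_EFin R (a + 1); rewrite addrK => <-; last by apply: lty; lra.
  rewrite -!EFinM; congr EFin.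
  rewrite /c powRN powRM ?invr_ge0 ?(ltW g0) ?(ltW p'0)//.
  have -> : p'^-1 `^ (a + 1) = (p' `^ (a + 1))^-1.
    by rewrite -powR_inv1 ?ltW// -powRrM mulN1r powRN.
  have -> : g 0 `^ (a + 1) = g 0 `^ a * g 0.
    by rewrite powRD ?powRr1 ?(ltW g0)//; apply/implyP => _; rewrite gt_eqF.
  have := powR_gt0 a g0; have := powR_gt0 (a + 1) p'0.
  set u := p' `^ _; set w := g 0 `^ _ => u0 w0.
  by field; rewrite !gt_eqF.
(* The crossing point is [inf S]. If [S] were empty, [k <= g] on the half line would give [p' <= p];
   here the strict inequality of the masses is used. *)
pose S := [set t : R | 0 < t /\ g t < k t].
have S0 : S !=set0.
  apply: contrapT => S_empty.
  have : (p'%:E <= p%:E)%E.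
    rewrite -intk -gp; apply: ge0_le_integral => //.
    - by move=> x _; rewrite lee_fin k0.
    - by apply/measurable_EFinP; exact: mk.
    - by apply/measurable_EFinP; exact: mgD.
    move=> x; rewrite /= in_itv/= andbT => x0; rewrite lee_fin leNgt.
    by apply/negP => gk; apply: S_empty; exists x.
  by rewrite lee_fin leNgt pp'.
have lbS : has_lbound S by exists 0 => x [/ltW].
have infS0 : 0 <= inf S by apply: lb_le_inf => // x [/ltW].
(* The product inequality with every term moved to the side where it is nonnegative, so that it can
   be integrated before the moment of [g] is known to be finite. *)
have key t : 0 < t -> t `^ a * g t + inf S `^ a * k t <= t `^ a * k t + inf S `^ a * g t.
  move=> t0; have [tS|tS|->] := ltgtP t (inf S).
  - have gk : k t <= g t.
      rewrite leNgt; apply/negP => gk.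
      by have : inf S <= t by [apply: ge_inf => //; split]; rewrite leNgt tS.
    have : t `^ a <= inf S `^ a by apply: ge0_ler_powR; rewrite ?nnegrE// ltW.
    by move: gk; set x := t `^ a; set y := inf S `^ a; nra.
  - have gk : g t <= k t.
      have [t1 [t10 gk1] t1t] := inf_lt S0 tS.
      exact: log_concave_below_exponential lg g_ge0 g0 t10 (ltW t1t) gk1.
    have : inf S `^ a <= t `^ a by apply: ge0_ler_powR; rewrite ?nnegrE// ltW.
    by move: gk; set x := t `^ a; set y := inf S `^ a; nra.
  - by rewrite addrC.
have msum (h1 h2 : R -> R) (D : set R) : measurable_fun D h1 -> measurable_fun D h2 ->
    measurable_fun D (fun t => (t `^ a * h1 t)%:E + (inf S `^ a * h2 t)%:E)%E.
  move=> m1 m2; apply: emeasurable_funD; apply/measurable_EFinP.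
    by apply: measurable_funM => //; exact: measurable_funTS.
  exact: measurable_funM.
have intsum (h1 h2 : R -> R) : measurable_fun (setT : set R) h1 ->
    measurable_fun (setT : set R) h2 -> (forall t, 0 <= h1 t) -> (forall t, 0 <= h2 t) ->
    (\int[mu]_(t in `]0%R, +oo[) ((t `^ a * h1 t)%:E + (inf S `^ a * h2 t)%:E) =
     \int[mu]_(t in `]0%R, +oo[) (t `^ a * h1 t)%:E +
     (inf S `^ a)%:E * \int[mu]_(t in `]0%R, +oo[) (h2 t)%:E)%E.
  move=> m1 m2 h10 h20; rewrite ge0_integralD//; first last.
  - by apply: measurable_funTS; apply/measurable_EFinP; exact: measurable_funM.
  - by move=> x _; rewrite lee_fin mulr_ge0 ?powR_ge0.
  - by apply: measurable_funTS; apply/measurable_EFinP; exact: measurable_funM.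
  - by move=> x _; rewrite lee_fin mulr_ge0 ?powR_ge0.
  congr (_ + _)%E; under eq_integral do rewrite EFinM.
  rewrite ge0_integralZl//; first last.
  - by rewrite lee_fin powR_ge0.
  - by move=> x _; rewrite lee_fin.
  - by apply: measurable_funTS; apply/measurable_EFinP.
have : (\int[mu]_(t in `]0%R, +oo[) (t `^ a * g t)%:E + (inf S `^ a)%:E * p'%:E <=
        (Gamma (a + 1) / g 0 `^ a * p' `^ (a + 1))%:E + (inf S `^ a)%:E * p%:E)%E.
  rewrite -intak -gp -intk -!intsum//.
  apply: ge0_le_integral => //.
  - by move=> x _; rewrite -EFinD lee_fin addr_ge0 ?mulr_ge0 ?powR_ge0.
  - exact: msum.
  - exact: msum.
  - move=> x; rewrite /= in_itv/= andbT => x0; rewrite -!EFinD lee_fin; exact: key.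
set A := (\int[mu]_(t in _) _)%E; set B := _ / _ * _ => AB.
(* Enlarging [p] to [p'] on the right makes the extra terms equal; they are finite, hence can be
   cancelled even if [A] were infinite. *)
have : (A + (inf S `^ a * p')%:E <= B%:E + (inf S `^ a * p')%:E)%E.
  apply: (le_trans AB); rewrite -EFinM leeD2l// lee_fin ler_wpM2l ?powR_ge0//.
  exact: ltW.
by rewrite leeD2rE.
Qed.

(** Limit of the strict case as [p'] decreases to [p]. With equal masses [g] could coincide with the
    exponential, and there would be no crossing to speak of. *)
Lemma log_concave_moment_half_line (g : R -> R) (a p : R) :
  measurable_fun (setT : set R) g -> (forall x, 0 <= g x) -> log_concave g ->
  0 < g 0 -> 0 <= a ->
  (\int[mu]_(t in `]0%R, +oo[) (g t)%:E = p%:E)%E ->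
  (\int[mu]_(t in `]0%R, +oo[) (t `^ a * g t)%:E <=
   (Gamma (a + 1) / g 0 `^ a * p `^ (a + 1))%:E)%E.
Proof.
move=> mg g_ge0 lg g0 a0 gp.
have p0 : 0 <= p.
  by rewrite -lee_fin -gp; apply: integral_ge0 => x _; rewrite lee_fin.
have := @log_concave_moment_lt g a p _ mg g_ge0 lg g0 a0 gp.
have : (0 <= \int[mu]_(t in `]0%R, +oo[) (t `^ a * g t)%:E)%E.
  by apply: integral_ge0 => x _; rewrite lee_fin mulr_ge0 ?powR_ge0.
have K0 : 0 < Gamma (a + 1) / g 0 `^ a.
  rewrite divr_gt0 ?powR_gt0// Gamma_gt0//; apply: Gamma_integral_lty; lra.
move: K0; set K := _ / _; case: (\int[mu]_(t in _) _)%E => [A| |] K0 A0 AK //; last first.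
  by have := AK (p + 1); rewrite ltrDl ltr01 => /(_ isT).
rewrite lee_fin in A0; rewrite lee_fin.
have a1 : 0 < a + 1 by lra.
have AK0 : 0 <= A / K := divr_ge0 A0 (ltW K0).
(* Inverting the power reduces the limit to [(A / K) ^ (1 / (a + 1)) <= p + e] for all [e > 0], so
   continuity of the power is not invoked. *)
have AKE : A = K * ((A / K) `^ (a + 1)^-1) `^ (a + 1).
  rewrite -powRrM mulVf ?gt_eqF// powRr1//.
  by rewrite mulrC divfK// gt_eqF.
suff : (A / K) `^ (a + 1)^-1 <= p.
  move=> h; rewrite {1}AKE ler_wpM2l ?(ltW K0)//.
  by apply: ge0_ler_powR; rewrite ?nnegrE ?powR_ge0// ltW.
apply/ler_addgt0Pr => e e0.
have := AK (p + e); rewrite ltrDl => /(_ e0); rewrite lee_fin => h.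
have pe0 : 0 <= p + e by rewrite addr_ge0// ltW.
have -> : p + e = ((p + e) `^ (a + 1)) `^ (a + 1)^-1.
  by rewrite -powRrM mulfV ?gt_eqF// powRr1.
apply: ge0_ler_powR; rewrite ?nnegrE ?invr_ge0 ?powR_ge0 ?AK0 ?(ltW a1)//.
by rewrite ler_pdivrMr// mulrC.
Qed.

(** The masses [p] and [q] on the two sides of [y] add up to 1, and [u ^ (a + 1) <= u] on [[0, 1]],
    so the two one-sided bounds together carry a factor at most [p + q = 1]. *)
Lemma log_concave_moment (f : R -> R) (a y : R) :
  measurable_fun (setT : set R) f -> (forall x, 0 <= f x) -> log_concave f ->
  (\int[mu]_x (f x)%:E = 1)%E -> 0 <= a -> 0 < f y ->
  (\int[mu]_x (`|x - y| `^ a * f x)%:E <= (Gamma (a + 1) / f y `^ a)%:E)%E.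
Proof.
move=> mf f0 lf f1 a0 fy.
have a1 : 0 < a + 1 by lra.
have lfr : log_concave (fun t => f (y + t)).
  by have := log_concave_affine y 1 lf; under eq_fun do rewrite mul1r.
have lfl : log_concave (fun t => f (y - t)).
  by have := log_concave_affine y (-1) lf; under eq_fun do rewrite mulN1r.
have mfr : measurable_fun (setT : set R) (fun t => f (y + t)).
  by apply: measurableT_comp => //; exact: measurable_funD.
have mfl : measurable_fun (setT : set R) (fun t => f (y - t)).
  by apply: measurableT_comp => //; exact: measurable_funB.
have mff : measurable_fun (setT : set R) (EFin \o f) by exact/measurable_EFinP.
have := ge0_integral_half_lines y mff; rewrite /= f1.
move=> /(_ (fun x => ltac:(rewrite lee_fin; exact: f0))).
have : (0 <= \int[mu]_(t in `]0%R, +oo[) (f (y + t))%:E)%E.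
  by apply: integral_ge0 => x _; rewrite lee_fin.
have : (0 <= \int[mu]_(t in `]0%R, +oo[) (f (y - t))%:E)%E.
  by apply: integral_ge0 => x _; rewrite lee_fin.
case Ep : (\int[mu]_(t in `]0%R, +oo[) (f (y + t))%:E)%E => [p| |] //;
case Eq : (\int[mu]_(t in `]0%R, +oo[) (f (y - t))%:E)%E => [q| |] //.
rewrite !lee_fin => q0 p0 [] pq1.
rewrite (ge0_integral_half_lines y); last 2 first.
- apply/measurable_EFinP; apply: measurable_funM => //.
  apply: (measurableT_comp (measurable_powR _)); apply: measurableT_comp => //.
  exact: measurable_funB.
- by move=> x; rewrite lee_fin mulr_ge0 ?powR_ge0.
have -> : (\int[mu]_(t in `]0%R, +oo[) (`|y + t - y| `^ a * f (y + t))%:E =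
    \int[mu]_(t in `]0%R, +oo[) (t `^ a * f (y + t))%:E)%E.
  apply: eq_integral => x; rewrite inE/= in_itv/= andbT => x0.
  by rewrite addrAC subrr add0r gtr0_norm.
have -> : (\int[mu]_(t in `]0%R, +oo[) (`|y - t - y| `^ a * f (y - t))%:E =
    \int[mu]_(t in `]0%R, +oo[) (t `^ a * f (y - t))%:E)%E.
  apply: eq_integral => x; rewrite inE/= in_itv/= andbT => x0.
  by rewrite addrAC subrr add0r normrN gtr0_norm.
have := @log_concave_moment_half_line _ a p mfr (fun=> f0 _) lfr.
rewrite addr0 => /(_ fy a0 Ep) Ip.
have := @log_concave_moment_half_line _ a q mfl (fun=> f0 _) lfl.
rewrite subr0 => /(_ fy a0 Eq) Iq.
apply: le_trans (leeD Ip Iq) _; rewrite -EFinD lee_fin -mulrDr.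
have K0 : 0 <= Gamma (a + 1) / f y `^ a.
  rewrite divr_ge0 ?powR_ge0// ltW// Gamma_gt0//; apply: Gamma_integral_lty; lra.
have pow_le u : 0 <= u -> u <= 1 -> u `^ (a + 1) <= u.
  rewrite le_eqVlt => /predU1P[<- _|u0 u1]; first by rewrite powR0// gt_eqF.
  by apply: ge1r_powR; rewrite ?u0 ?u1//; lra.
have : p `^ (a + 1) + q `^ (a + 1) <= 1.
  have := pow_le _ p0; have := pow_le _ q0; lra.
by move=> /(ler_wpM2l K0); rewrite mulr1.
Qed.

End moment.

(** * Expectations as integrals against the density *)

Section density.
Context {d : measure_display} {T : measurableType d} {R : realType}.
Context {P : probability T R} {X : {RV P >-> R}} {f : R -> R}.
Local Open Scope classical_set_scope.
Local Notation mu := (@lebesgue_measure R).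
Hypothesis pdf_f : has_pdf X f.

Lemma measurable_pdf (D : set R) : measurable_fun D (fun x => (f x)%:E).
Proof. by apply: measurable_funTS; apply/measurable_EFinP; case: pdf_f. Qed.

Lemma integral_pdf : (\int[mu]_x (f x)%:E = 1)%E.
Proof.
case: pdf_f => mf f0 fE.
by rewrite -(fE setT measurableT) /distribution /pushforward preimage_setT probability_setT.
Qed.

(* [lebesgue_measure] lives on [measurableTypeR R], whose display is not
   that of the codomain of [X]. *)
Let mX : measurable_fun [set: T] (X : T -> measurableTypeR R).
Proof. by move=> _ A mA; exact: (measurable_funPT X). Qed.

Let X' : {RV P >-> measurableTypeR R} :=
  HB.pack (X : T -> measurableTypeR R) (isMeasurableFun.Build _ _ _ _ _ mX).

Let nu : probability (measurableTypeR R) R := distribution P X'.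

(** The law of [X] is absolutely continuous, and its Radon-Nikodym derivative equals [f] almost
    everywhere since both have the same integral over every measurable set. *)
Lemma ge0_expectation_pdf (g : R -> \bar R) :
  measurable_fun (setT : set R) g -> (forall x, 0 <= g x)%E ->
  (\int[P]_w g (X w) = \int[mu]_x (g x * (f x)%:E))%E.
Proof.
move=> mg g0; case: pdf_f => mf f0 fE.
have numu : nu `<< mu.
  apply/null_content_dominatesP => A mA A0.
  rewrite [LHS](fE A mA); apply: null_set_integral => //; exact: measurable_pdf.
transitivity (\int[nu]_x g x)%E.
  by rewrite ge0_integral_distribution.
rewrite -(Radon_Nikodym_SigmaFinite.change_of_variables numu g0 measurableT mg).
have int_rn := Radon_Nikodym_SigmaFinite.f_integrable numu.
apply: ae_eq_integral => //.
- by apply: emeasurable_funM => //; exact: measurable_int int_rn.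
- by apply: emeasurable_funM => //; exact: measurable_pdf.
apply: ae_eqe_mul2l; apply: integral_ae_eq => //.
  exact: measurable_pdf.
move=> A _ mA; rewrite -Radon_Nikodym_SigmaFinite.f_integral//.
exact: fE.
Qed.

(** Positive and negative parts are transferred separately; multiplying by [f >= 0] commutes with
    taking them. Integrability ensures that [fine] loses nothing. *)
Lemma expectation_pdf : mu.-integrable setT (fun x => (x * f x)%:E) ->
  (\int[mu]_x (x * f x)%:E = (fine 'E_P[X]%E)%:E)%E.
Proof.
move=> iX; have [mf f0 _] := pdf_f.
have posE (g : R -> R) : measurable_fun (setT : set R) g ->
    (\int[P]_w maxe (g (X w))%:E 0 = \int[mu]_x maxe (g x * f x)%:E 0)%E.
  move=> mg; rewrite (ge0_expectation_pdf (g := fun x => maxe (g x)%:E 0%E)).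
  - by apply: eq_integral => x _; rewrite maxe_pMl ?lee_fin ?f0// mul0e.
  - by apply: measurable_maxe => //; exact/measurable_EFinP.
  - by move=> x; rewrite le_max lexx orbT.
have EX : ('E_P[X] = \int[mu]_x (x * f x)%:E)%E.
  rewrite expectation.unlock integralE [RHS]integralE; congr (_ - _)%E.
    by rewrite unlock; exact: posE id (@measurable_id _ _ _).
  rewrite unlock; have negE := posE (@GRing.opp R) (measurable_funN (@measurable_id _ _ _)).
  transitivity (\int[mu]_x maxe (- x * f x)%:E 0)%E; first exact: negE.
  by apply: eq_integral => x _; rewrite mulNr EFinN.
by rewrite EX fineK//; exact: integrable_fin_num.
Qed.

End density.

(** * Log-concave densities: the mean, the supporting line and the entropy integral *)

Section log_concave_density.
Context {R : realType}.
Local Open Scope classical_set_scope.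
Local Notation mu := (@lebesgue_measure R).
Variable f : R -> R.
Hypothesis mf : measurable_fun (setT : set R) f.
Hypothesis f_ge0 : forall x, 0 <= f x.
Hypothesis lf : log_concave f.
Hypothesis f1 : (\int[mu]_x (f x)%:E = 1)%E.

Lemma measurable_centered_moment (a m : R) :
  measurable_fun (setT : set R) (fun x => (`|x - m| `^ a * f x)%:E).
Proof.
apply/measurable_EFinP; apply: measurable_funM => //.
apply: (measurableT_comp (measurable_powR _)); apply: measurableT_comp => //.
exact: measurable_funB.
Qed.

Lemma density_pos_ex : exists y, 0 < f y.
Proof.
apply: contrapT => h; have := f1; rewrite integral0_eq => [/eqP|x _].
  by rewrite eqe eq_sym oner_eq0.
congr EFin; apply/eqP; rewrite eq_le f_ge0 andbT leNgt.
by apply/negP => fx; apply: h; exists x.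
Qed.

(** A zero moment would force [f] to vanish almost everywhere off the null set [{m}], against total
    mass 1. *)
Lemma centered_moment_gt0 (a m : R) :
  (0 < \int[mu]_x (`|x - m| `^ a * f x)%:E)%E.
Proof.
rewrite lt0e integral_ge0 ?andbT; last first.
  by move=> x _; rewrite lee_fin mulr_ge0 ?powR_ge0.
apply/negP => /eqP V0.
have mM := measurable_centered_moment a m.
have : (\int[mu]_x `|(`|x - m| `^ a * f x)%:E| = 0)%E.
  rewrite -[RHS]V0; apply: eq_integral => x _.
  by rewrite gee0_abs// lee_fin mulr_ge0 ?powR_ge0.
move=> /(proj1 (ae_eq_integral_abs mu measurableT mM)) ae0.
have aem : {ae mu, forall x, x <> m}.
  exists [set m]; split => //; first exact: lebesgue_measure_set1.
  by move=> x /= /contrapT.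
have : ae_eq mu setT (EFin \o f) (cst 0%E).
  apply: filterS2 ae0 aem => x /= + /eqP xm _ => /(_ I) [].
  move=> /eqP; rewrite mulf_eq0 powR_eq0 normr_eq0 subr_eq0 (negbTE xm)/=.
  by move=> /eqP ->.
move=> /(ge0_ae_eq_integral measurableT _ _ _ _) h.
have := f1; rewrite h ?integral0//.
- by move=> /eqP; rewrite eqe eq_sym oner_eq0.
- by apply/measurable_EFinP.
- by move=> x _; rewrite lee_fin.
Qed.

Lemma integrable_density : mu.-integrable setT (fun x => (f x)%:E).
Proof.
apply/integrableP; split; first exact/measurable_EFinP.
under eq_integral do rewrite gee0_abs ?lee_fin//.
by rewrite f1 ltry.
Qed.

Lemma integrable_centered_moment (a m : R) : 0 <= a -> 0 < f m ->
  mu.-integrable setT (fun x => (`|x - m| `^ a * f x)%:E).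
Proof.
move=> a0 fm; apply/integrableP; split; first exact: measurable_centered_moment.
under eq_integral do rewrite gee0_abs ?lee_fin ?mulr_ge0 ?powR_ge0//.
apply: le_lt_trans (log_concave_moment mf f_ge0 lf f1 a0 fm) _.
exact: ltry.
Qed.

(** Write [x = (x - y) + y] with [f y > 0]: the first moment about [y] is finite by comparison. *)
Lemma integrable_mean : mu.-integrable setT (fun x => (x * f x)%:E).
Proof.
have [y fy] := density_pos_ex.
have my : measurable_fun (setT : set R) (fun x => ((x - y) * f x)%:E).
  by apply/measurable_EFinP; apply: measurable_funM => //; exact: measurable_funB.
have : mu.-integrable setT (fun x => ((x - y) * f x)%:E + y%:E * (f x)%:E)%E.
  apply: integrableD => //; last by apply: integrableZl => //; exact: integrable_density.
  apply: le_integrable (integrable_centered_moment ler01 fy) => //.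
  move=> x _; rewrite lee_fin powRr1// normrM (ger0_norm (f_ge0 x)).
  by rewrite normrM normr_id (ger0_norm (f_ge0 x)).
apply: eq_integrable => // x _; rewrite -EFinM -EFinD; congr EFin; ring.
Qed.

Variable m : R.
Hypothesis fm : (\int[mu]_x (x * f x)%:E = m%:E)%E.

Lemma integrable_affine_density (p q : R) :
  mu.-integrable setT (fun x => ((p + q * x) * f x)%:E).
Proof.
have : mu.-integrable setT (fun x => p%:E * (f x)%:E + q%:E * (x * f x)%:E)%E.
  apply: integrableD => //; apply: integrableZl => //.
    exact: integrable_density.
  exact: integrable_mean.
apply: eq_integrable => // x _; rewrite -!EFinM -EFinD; congr EFin; ring.
Qed.

Lemma integral_affine_density (p q : R) :
  (\int[mu]_x ((p + q * x) * f x)%:E = (p + q * m)%:E)%E.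
Proof.
transitivity (\int[mu]_x (p%:E * (f x)%:E + q%:E * (x * f x)%:E))%E.
  by apply: eq_integral => x _; rewrite -!EFinM -EFinD; congr EFin; ring.
rewrite integralD//=; last 2 first.
- by apply: integrableZl => //; exact: integrable_density.
- by apply: integrableZl => //; exact: integrable_mean.
rewrite !integralZl//; last 2 first.
- exact: integrable_mean.
- exact: integrable_density.
by rewrite f1 fm mule1.
Qed.

(** Otherwise [|x - m| = m - x] wherever [f] is nonzero, and the first absolute centred moment would
    be [m - m = 0]. *)
Lemma density_pos_right_mean : exists2 b, m < b & 0 < f b.
Proof.
apply: contrapT => h.
have f0 b : m < b -> f b = 0.
  move=> mb; apply/eqP; rewrite eq_le f_ge0 andbT leNgt.
  by apply/negP => fb; apply: h; exists b.
have := centered_moment_gt0 1 m.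
have -> : (\int[mu]_x (`|x - m| `^ 1 * f x)%:E = \int[mu]_x ((m + -1 * x) * f x)%:E)%E.
  apply: eq_integral => x _; rewrite powRr1//; congr EFin.
  have [mx|xm] := ltP m x; first by rewrite f0// !mulr0.
  by rewrite ler0_norm ?subr_le0//; congr (_ * _); ring.
by rewrite integral_affine_density mulN1r subrr ltxx.
Qed.

Lemma density_pos_left_mean : exists2 b, b < m & 0 < f b.
Proof.
apply: contrapT => h.
have f0 b : b < m -> f b = 0.
  move=> mb; apply/eqP; rewrite eq_le f_ge0 andbT leNgt.
  by apply/negP => fb; apply: h; exists b.
have := centered_moment_gt0 1 m.
have -> : (\int[mu]_x (`|x - m| `^ 1 * f x)%:E = \int[mu]_x ((- m + 1 * x) * f x)%:E)%E.
  apply: eq_integral => x _; rewrite powRr1//; congr EFin.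
  have [mx|xm] := ltP x m; first by rewrite f0// !mulr0.
  by rewrite ger0_norm ?subr_ge0//; congr (_ * _); ring.
by rewrite integral_affine_density mul1r addNr ltxx.
Qed.

Lemma density_mean_gt0 : 0 < f m.
Proof.
have [b mb fb] := density_pos_right_mean.
have [a am fa] := density_pos_left_mean.
have ab : 0 < b - a by lra.
(* The weight that represents [m] as a convex combination of [a] and [b]. *)
have t0 : 0 <= (b - m) / (b - a) by rewrite divr_ge0//; lra.
have t1 : (b - m) / (b - a) <= 1 by rewrite ler_pdivrMr//; lra.
have := lf a b t0 t1.
rewrite (_ : _ * a + _ = m); last by field; rewrite gt_eqF.
by apply: lt_le_trans; rewrite mulr_gt0 ?powR_gt0.
Qed.

(** Chord slopes of the concave function [ln f] decrease: this is log-concavity at [m], seen as a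
    combination of [x] and [z], with denominators cleared. *)
Lemma ln_density_slopes (x z : R) : x < m -> m < z -> 0 < f x -> 0 < f z ->
  (ln (f z) - ln (f m)) / (z - m) <= (ln (f x) - ln (f m)) / (x - m).
Proof.
move=> xm mz fx fz.
have xz : 0 < z - x by lra.
have t0 : 0 <= (z - m) / (z - x) by rewrite divr_ge0//; lra.
have t1 : (z - m) / (z - x) <= 1 by rewrite ler_pdivrMr//; lra.
have := lf x z t0 t1.
rewrite (_ : _ * x + _ = m); last by field; rewrite gt_eqF.
rewrite -ler_ln ?posrE ?mulr_gt0 ?powR_gt0 ?density_mean_gt0//.
rewrite lnM ?posrE ?powR_gt0// !ln_powR.
set u := ln (f x); set v := ln (f z); set w := ln (f m).
rewrite -(ler_pM2r xz).
have -> : ((z - m) / (z - x) * u + (1 - (z - m) / (z - x)) * v) * (z - x) =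
    (z - m) * u + (m - x) * v by field; rewrite gt_eqF.
move=> h.
rewrite ler_pdivrMr ?subr_gt0// mulrAC ler_ndivlMr ?subr_lt0//.
nra.
Qed.

(** Without differentiability the slope is the supremum of the chord slopes to the right of [m]. A
    point of positive density on the right makes the set nonempty, one on the left bounds it. *)
Lemma density_log_tangent : exists s, forall x, 0 < f x ->
  ln (f x) <= ln (f m) + s * (x - m).
Proof.
have [b mb fb] := density_pos_right_mean.
have [a am fa] := density_pos_left_mean.
pose S := [set (ln (f z) - ln (f m)) / (z - m) | z in [set z | m < z /\ 0 < f z]].
have ubS x : x < m -> 0 < f x -> ubound S ((ln (f x) - ln (f m)) / (x - m)).
  by move=> xm fx _ [z [mz fz] <-]; exact: ln_density_slopes.
have S0 : S !=set0 by exists ((ln (f b) - ln (f m)) / (b - m)), b.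
exists (sup S) => x fx; have [xm|mx|->] := ltgtP x m; last by lra.
- have : sup S <= (ln (f x) - ln (f m)) / (x - m) by apply: ge_sup => //; exact: ubS.
  by rewrite ler_ndivlMr ?subr_lt0//; lra.
- have : (ln (f x) - ln (f m)) / (x - m) <= sup S.
    apply: ub_le_sup; last by exists x.
    by exists ((ln (f a) - ln (f m)) / (a - m)); exact: ubS.
  by rewrite ler_pdivrMr ?subr_gt0//; lra.
Qed.

Variable a : R.
Hypothesis a1 : 1 <= a.

(* Gibbs' inequality against the density [exp (- |x - m| ^ a / (a v)) / Z]
   gives the lower bound, the tangent of the concave function [ln f] at the
   mean gives the upper bound. *)
Lemma integral_xlnx_bounds (v : R) (Z := 2 / a * Gamma (1 / a) * (a * v) `^ (1 / a)) :
  (\int[mu]_x (`|x - m| `^ a * f x)%:E = v%:E)%E ->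
  ((- (ln Z + 1 / a))%:E <= \int[mu]_x (f x * ln (f x))%:E <= (ln (f m))%:E)%E.
Proof.
move=> vE.
have a0 : 0 < a by exact: lt_le_trans a1.
have v0 : 0 < v by rewrite -lte_fin -vE centered_moment_gt0.
have Z0 : 0 < Z.
  rewrite !mulr_gt0 ?invr_gt0 ?powR_gt0 ?mulr_gt0//.
  by rewrite Gamma_gt0// div1r; exact: Gamma_inv_integral_lty.
pose g x := expR (- (`|x - m| `^ a / (a * v))).
have gZ : (\int[mu]_x (g x)%:E = Z%:E)%E by exact: integral_generalized_gaussian.
have mg : measurable_fun (setT : set R) (fun x => (g x)%:E).
  apply/measurable_EFinP; apply: measurableT_comp => //.
  apply: measurable_funN; apply: measurable_funM => //.
  apply: (measurableT_comp (measurable_powR _)); apply: measurableT_comp => //.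
  exact: measurable_funB.
have ig : mu.-integrable setT (fun x => (g x)%:E).
  apply/integrableP; split => //.
  under eq_integral do rewrite gee0_abs ?lee_fin ?expR_ge0//.
  by rewrite gZ ltry.
have iM := integrable_centered_moment (ltW a0) density_mean_gt0.
(* With [q = g / Z] the comparison density, this is [f + f ln q - q]. Its integral is
   [(1 - ln Z) - 1 / a - 1]. *)
pose lo x : \bar R := (((1 - ln Z)%:E * (f x)%:E -
  (a * v)^-1%:E * (`|x - m| `^ a * f x)%:E) - Z^-1%:E * (g x)%:E)%E.
have i1 : mu.-integrable setT (fun x => (1 - ln Z)%:E * (f x)%:E)%E.
  by apply: integrableZl => //; exact: integrable_density.
have i2 : mu.-integrable setT (fun x => (a * v)^-1%:E * (`|x - m| `^ a * f x)%:E)%E.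
  exact: integrableZl.
have i3 : mu.-integrable setT (fun x => Z^-1%:E * (g x)%:E)%E by exact: integrableZl.
have i12 := integrableB measurableT i1 i2.
have ilo : mu.-integrable setT lo by exact: (integrableB measurableT i12 i3).
have int_lo : (\int[mu]_x lo x = (- (ln Z + 1 / a))%:E)%E.
  rewrite (integralB measurableT i12 i3) (integralB measurableT i1 i2).
  rewrite !integralZl//; last exact: integrable_density.
  rewrite f1 vE gZ -!EFinM -!EFinB; congr EFin; field.
  by rewrite !gt_eqF.
have [s tangent] := density_log_tangent.
(* The supporting line times [f]; as [m] is the mean, the slope drops out of the integral. *)
pose up x := ((ln (f m) - s * m + s * x) * f x)%:E.
have iup : mu.-integrable setT up by exact: integrable_affine_density.
have int_up : (\int[mu]_x up x = (ln (f m))%:E)%E.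
  by rewrite /up integral_affine_density subrK.
pose F x := (f x * ln (f x))%:E.
have lo_le x : (lo x <= F x)%E.
  rewrite /lo /F -!EFinM -!EFinB lee_fin.
  have [fx0|fxN0] := eqVneq (f x) 0.
    by rewrite fx0 !mulr0 !mul0r subrr sub0r oppr_le0 mulr_ge0 ?expR_ge0 ?invr_ge0 ?(ltW Z0).
  have fx : 0 < f x by rewrite lt0r fxN0 f_ge0.
  (* The exponent is [ln (g x / (Z f x))]; multiplying [1 + y <= exp y] by [f x] gives the claim. *)
  have := expR_ge1Dx (- ln Z - `|x - m| `^ a / (a * v) - ln (f x)).
  rewrite !expRD !expRN !lnK ?posrE// -expRN -/(g x).
  move=> /(ler_wpM2l (f_ge0 x)).
  have -> : f x * (Z^-1 * g x / f x) = Z^-1 * g x by field; rewrite !gt_eqF.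
  set u := `|x - m| `^ a; set y := (a * v)^-1; set w := Z^-1 * g x.
  by lra.
have le_up x : (F x <= up x)%E.
  rewrite /up /F lee_fin; have [->|fxN0] := eqVneq (f x) 0; first by rewrite mul0r mulr0.
  have fx : 0 < f x by rewrite lt0r fxN0 f_ge0.
  by rewrite mulrC ler_wpM2r//; have := tangent x fx; lra.
have iF : mu.-integrable setT F.
  have : mu.-integrable setT (fun x => `|lo x| + `|up x|)%E.
    by apply: integrableD => //; exact: integrable_abse.
  apply: le_integrable => //.
    by apply/measurable_EFinP; apply: measurable_funM => //; exact: measurableT_comp.
  move=> x _; have := lo_le x; have := le_up x.
  rewrite /lo /F /up -!EFinM -!EFinB !lee_fin => h1 h2.
  rewrite /= [X in _ <= X]ger0_norm ?addr_ge0//; set l := (_ - _ - _) in h2 *.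
  have [F0|F0] := leP 0 (f x * ln (f x)).
    rewrite (ger0_norm F0); apply: le_trans h1 _.
    by apply: le_trans (ler_norm _) _; rewrite lerDr.
  rewrite (ltr0_norm F0); apply: (@le_trans _ _ (- l)); first by lra.
  by rewrite -normrN; apply: le_trans (ler_norm _) _; rewrite lerDl.
rewrite -int_lo -int_up; apply/andP; split; apply: le_integral => // x _; exact: le_up.
Qed.

End log_concave_density.

(** * The two entropy bounds *)

Theorem corollary2 (R : realType) (d : measure_display) (T : measurableType d)
    (P : probability T R) (X : {RV P >-> R}) (f : R -> R) (alpha : R)
    (pdf_f : has_pdf X f) (logconcave_f : log_concave f) (alpha_ge1 : 1 <= alpha) :
  (lne (sigma X alpha / (D_ alpha)%:E) <= entropy f)%E /\
  (entropy f <= lne ((C_ alpha)%:E * sigma X alpha))%E.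
Proof.
have [mf f0 _] := pdf_f; have f1 := integral_pdf pdf_f.
set m := fine 'E_P[X]%E.
have mean_f : (\int[lebesgue_measure]_x (x * f x)%:E = m%:E)%E.
  by apply: (expectation_pdf pdf_f); exact: integrable_mean.
have a0 : 0 < alpha by lra.
have fm0 := density_mean_gt0 mf f0 logconcave_f f1 mean_f.
have momentE : ('E_P[fun w => (`|X w - m| `^ alpha)%R] =
    \int[lebesgue_measure]_x (`|x - m| `^ alpha * f x)%:E)%E.
  rewrite unlock (ge0_expectation_pdf pdf_f (g := fun x => (`|x - m| `^ alpha)%:E))//.
  apply/measurable_EFinP; apply: (measurableT_comp (measurable_powR _)).
  by apply: measurableT_comp => //; exact: measurable_funB.
have := log_concave_moment mf f0 logconcave_f f1 (ltW a0) fm0.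
have := centered_moment_gt0 mf f0 f1 alpha m.
rewrite /sigma -/m momentE.
(* The moment lies strictly above 0 and below a real number, so only the finite case survives. *)
case vE : (\int[lebesgue_measure]_x (`|x - m| `^ alpha * f x)%:E)%E => [v| |]//.
rewrite lte_fin lee_fin => v0 v_le.
have /andP[lo up] := integral_xlnx_bounds mf f0 logconcave_f f1 mean_f alpha_ge1 vE.
have G0 : 0 < Gamma (alpha + 1) by apply: Gamma_gt0; apply: Gamma_integral_lty; lra.
have D0 : 0 < D_ alpha by exact: powR_gt0.
have s0 : 0 < v `^ (1 / alpha) by exact: powR_gt0.
have Gi0 : 0 < Gamma (1 / alpha).
  by rewrite div1r; apply: Gamma_gt0; exact: Gamma_inv_integral_lty.
have ai0 : 0 <= 1 / alpha by rewrite divr_ge0// ltW.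
rewrite poweR_EFin; split.
- rewrite inver gt_eqF// -EFinM lne_EFin ?divr_gt0//.
  rewrite /entropy leeNr; apply: le_trans up _.
  rewrite -EFinN lee_fin -lnV ?posrE ?divr_gt0// ler_ln ?posrE ?invr_gt0 ?divr_gt0//.
  rewrite invf_div ler_pdivlMr//.
  (* What remains is the [1 / alpha] power of [f m ^ alpha * v <= Gamma (alpha + 1)]. *)
  have -> : f m = (f m `^ alpha) `^ (1 / alpha).
    by rewrite -powRrM div1r mulfV ?gt_eqF// powRr1 ?ltW.
  rewrite -powRM ?powR_ge0 ?(ltW v0)//.
  apply: ge0_ler_powR; rewrite ?nnegrE ?mulr_ge0 ?powR_ge0 ?(ltW v0) ?(ltW G0)//.
    by rewrite invr_ge0 ltW.
  by rewrite mulrC -ler_pdivlMr ?powR_gt0.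
- have C0 : 0 < C_ alpha by rewrite !mulr_gt0 ?powR_gt0 ?invr_gt0 ?mulr_gt0 ?expR_gt0.
  rewrite -EFinM lne_EFin; last exact: mulr_gt0.
  rewrite /entropy leeNl; apply: le_trans lo.
  rewrite -EFinN lee_fin lerN2.
  (* Moving [v] under the power exhibits the normalising constant [Z]; the leftover factor
     [exp (1 / alpha)] accounts for the summand [1 / alpha] in the Gibbs bound. *)
  have -> : C_ alpha * v `^ (1 / alpha) =
      2 / alpha * Gamma (1 / alpha) * (alpha * v) `^ (1 / alpha) * expR (1 / alpha).
    rewrite /C_ !powRM ?expR_ge0 ?(ltW a0) ?(ltW v0)// -expRM !mul1r; ring.
  have Z0 : 0 < 2 / alpha * Gamma (1 / alpha) * (alpha * v) `^ (1 / alpha).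
    by rewrite !mulr_gt0 ?powR_gt0 ?invr_gt0 ?mulr_gt0.
  by rewrite [leRHS]lnM ?posrE ?expR_gt0// expRK.
Qed.
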